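(* Let $\mathbf X={}^{T}(x_0,x_1,x_2)$ be real numbers with $0<x_0<x_1<x_2$ that are rationally dependent. Then the Smallest Vector Algorithm applied to $\mathbf X$ produces, at some step $s$, an integer triple $(\mathbf g_0^{(s)},\mathbf g_1^{(s)},\mathbf g_2^{(s)})$ such that $\|\mathbf g_0^{(s)\prime\prime}\|=\mathbf g_0^{(s)}\bullet\mathbf X=0$. In particular, $\mathbf g_0^{(s)}$ gives the coefficients of an integral linear dependence relation among $x_0,x_1,x_2$.
   Context: Use the Euclidean norm and inner product $\bullet$ on $\mathbb R^3$. Set $\mathbb D=\mathbb R\mathbf X$ and $\mathbb P=\mathbb D^{\perp}$. For $\mathbf h\in\mathbb R^3$, write $\mathbf h'$ for its orthogonal projection on $\mathbb P$ and $\mathbf h''$ for its orthogonal projection on $\mathbb D$. The Smallest Vector Algorithm (SVA) produces integer $3\times3$ matrices $\mathbf G^{(s)}=(\mathbf g_0^{(s)},\mathbf g_1^{(s)},\mathbf g_2^{(s)})$, given by their columns, as follows. - $\mathbf G^{(0)}=\mathbf I$. - Given $\mathbf G^{(s)}$ (superscripts omitted), let $\Delta_{\min}=\min(\|\mathbf g_1'-\mathbf g_0'\|,\|\mathbf g_2'-\mathbf g_1'\|,\|\mathbf g_2'-\mathbf g_0'\|)$. Define $(\mathbf f_0,\mathbf f_1,\mathbf f_2)$ by: - $(\mathbf g_0,\mathbf g_1-\mathbf g_0,\mathbf g_2)$ if $\Delta_{\min}=\|\mathbf g_1'-\mathbf g_0'\|$; - $(\mathbf g_0,\mathbf g_1,\mathbf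 g_2-\mathbf g_1)$ if $\Delta_{\min}=\|\mathbf g_2'-\mathbf g_1'\|$; - $(\mathbf g_0,\mathbf g_1,\mathbf g_2-\mathbf g_0)$ if $\Delta_{\min}=\|\mathbf g_2'-\mathbf g_0'\|$. - $\mathbf G^{(s+1)}$ is any permutation of the columns $\mathbf f_0,\mathbf f_1,\mathbf f_2$ such that $\|\mathbf g_0^{(s+1)\prime\prime}\|\le\|\mathbf g_1^{(s+1)\prime\prime}\|\le\|\mathbf g_2^{(s+1)\prime\prime}\|$. *)

(* Defs.v *)
From HB Require Import structures.
From mathcomp Require Import all_boot all_order all_algebra all_fingroup.
From mathcomp Require Import reals.

Set Implicit Arguments.
Unset Strict Implicit.
Unset Printing Implicit Defensive.

Import Order.TTheory GRing.Theory Num.Theory.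
Local Open Scope ring_scope.

Definition dot (R : realType) (u v : 'cV[R]_3) : R := \sum_i u i 0 * v i 0.

Definition enorm (R : realType) (u : 'cV[R]_3) : R := Num.sqrt (dot u u).

Definition rvec (R : realType) (h : 'cV[int]_3) : 'cV[R]_3 :=
  map_mx (fun z : int => z%:~R) h.
Arguments rvec R h : clear implicits.

(* Orthogonal projections h'' on the line D = R X and h' on P = D^perp, for
   X != 0; see projDP, projPP and projPD below. *)
Definition projD (R : realType) (X h : 'cV[R]_3) : 'cV[R]_3 :=
  (dot h X / dot X X) *: X.

Definition projP (R : realType) (X h : 'cV[R]_3) : 'cV[R]_3 := h - projD X h.

Definition rationally_dependent (R : realType) (X : 'cV[R]_3) : Prop :=
  exists2 c : 'cV[rat]_3, c != 0 & \sum_i ratr (c i 0) * X i 0 = 0.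

Definition mx_of_cols (f0 f1 f2 : 'cV[int]_3) : 'M[int]_3 :=
  \matrix_(i, j) (nth 0 [:: f0; f1; f2] j) i 0.

Definition SVA_dist (R : realType) (X : 'cV[R]_3) (G : 'M[int]_3) (i j : 'I_3)
    : R :=
  enorm (projP X (rvec R (col j G)) - projP X (rvec R (col i G))).

Definition SVA_dmin (R : realType) (X : 'cV[R]_3) (G : 'M[int]_3) : R :=
  Num.min (Num.min (SVA_dist X G 0 1) (SVA_dist X G 1 2)) (SVA_dist X G 0 2).

(* A relation rather than a function: when the minimum is attained several
   times, each of the corresponding subtractions is allowed. *)
Variant SVA_subtract (R : realType) (X : 'cV[R]_3) (G : 'M[int]_3) :
    'M[int]_3 -> Prop :=
  | SVA_sub10 of SVA_dmin X G = SVA_dist X G 0 1 :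
      SVA_subtract X G (mx_of_cols (col 0 G) (col 1 G - col 0 G) (col 2 G))
  | SVA_sub21 of SVA_dmin X G = SVA_dist X G 1 2 :
      SVA_subtract X G (mx_of_cols (col 0 G) (col 1 G) (col 2 G - col 1 G))
  | SVA_sub20 of SVA_dmin X G = SVA_dist X G 0 2 :
      SVA_subtract X G (mx_of_cols (col 0 G) (col 1 G) (col 2 G - col 0 G)).

Definition SVA_sorted (R : realType) (X : 'cV[R]_3) (G : 'M[int]_3) : Prop :=
  enorm (projD X (rvec R (col 0 G))) <= enorm (projD X (rvec R (col 1 G)))
    <= enorm (projD X (rvec R (col 2 G))).

Definition SVA_step (R : realType) (X : 'cV[R]_3) (G G' : 'M[int]_3) : Prop :=
  exists F : 'M[int]_3, exists s : 'S_3,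
    [/\ SVA_subtract X G F, G' = col_perm s F & SVA_sorted X G'].

Definition SVA_run (R : realType) (X : 'cV[R]_3) (G : nat -> 'M[int]_3) : Prop :=
  G 0%N = 1%:M /\ forall s : nat, SVA_step X (G s) (G s.+1).

Lemma dot_neq0 (R : realType) (X : 'cV[R]_3) : X != 0 -> dot X X != 0.
Proof.
apply: contra => /eqP dX; apply/eqP/matrixP => i j; rewrite ord1 mxE.
have /(_ i isT)/eqP : forall k : 'I_3, true -> X k 0 * X k 0 = 0.
  by apply: (psumr_eq0P _ dX) => k _; rewrite -expr2 sqr_ge0.
by rewrite mulf_eq0 orbb => /eqP.
Qed.

Lemma projDP (R : realType) (X h : 'cV[R]_3) : exists a, projD X h = a *: X.
Proof. by exists (dot h X / dot X X). Qed.

Lemma projPP (R : realType) (X h : 'cV[R]_3) :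
  X != 0 -> dot (projP X h) X = 0.
Proof.
move=> X0; rewrite /projP /projD; set a := _ / _.
have -> : dot (h - a *: X) X = dot h X - a * dot X X.
  rewrite /dot mulr_sumr -sumrB; apply: eq_bigr => i _.
  by rewrite !mxE mulrBl -mulrA.
by rewrite divfK ?subrr // dot_neq0.
Qed.

Lemma projPD (R : realType) (X h : 'cV[R]_3) : projP X h + projD X h = h.
Proof. by rewrite subrK. Qed.

(* Main.v *)
Require Import Defs.
From HB Require Import structures.
From mathcomp Require Import all_boot all_order all_algebra all_fingroup.
From mathcomp Require Import boolp reals.
From mathcomp Require Import ring lra zify.

Set Implicit Arguments.
Unset Strict Implicit.
Unset Printing Implicit Defensive.

Import Order.TTheory GRing.Theory Num.Theory.
Local Open Scope ring_scope.

(** Write [y_k = g_k . X] and suppose that no [y_k] ever vanishes; they are then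
    positive and each step lowers one of them. Two facts constrain the triangle
    of the projections [g_k']: [X] is a combination of the columns with positive
    coefficients, so [sum_k b_k g_k' = 0] with [b_k > 0]; and if [c] is a nonzero
    integer relation, then [c = sum_k a_k g_k] with integers [a_k] satisfying
    [sum_k a_k y_k = 0], hence not all of the same sign. Together they place the
    [g_k'] within [|c|] of a line, with one of them on the other side of the
    origin from the two others. For such a flat triangle the smallest side is at
    most [rho = max_k |g_k'|] unless one of its endpoints has norm at most
    [10 |c|].

    Columns with [|g'|] bounded come from a finite set of integer vectors, so
    there is a monotone [phi : R -> nat] such that [sum_k phi(y_k)], which never
    increases, drops whenever such a column takes part in a subtraction. Since
    [rho] at most doubles in a step, [rho * 2 ^ (sum_k phi(y_k))] never
    increases, and [rho] is bounded. All columns now come from a finite set, and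
    a second potential of this kind would decrease at every step. *)

(** * Case analysis on three indices *)

Lemma ord3P (k : 'I_3) : [\/ k = 0, k = 1 | k = 2].
Proof.
by case: k => [[|[|[|k]]]] // kP; [constructor 1|constructor 2|constructor 3];
  apply: val_inj.
Qed.

(** Serves to name the remaining index, and to split sums, when two distinct indices are given in no
    particular order. *)
Lemma ord3_third (p q : 'I_3) : p != q ->
  exists r : 'I_3, [/\ r != p, r != q, forall k, [\/ k = p, k = q | k = r] &
    forall (V : nmodType) (F : 'I_3 -> V), \sum_k F k = F p + F q + F r].
Proof.
move=> pq.
have [r [rp rq]] : exists r : 'I_3, r != p /\ r != q.
  case: p q pq => [[|[|[|p]]]] // hp [[|[|[|q]]]] // hq _;
    by [exists 0 | exists 1 | exists 2].
have all3 k : [\/ k = p, k = q | k = r].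
  case: (eqVneq k p) => [->|kp]; first by constructor.
  case: (eqVneq k q) => [->|kq]; first by constructor.
  constructor 3; apply: val_inj; move: p q r k pq rp rq kp kq.
  by do 4! case=> [[|[|[|?]]] ?] //.
exists r; split=> // V F.
rewrite (bigD1 p) //= (bigD1 q) 1?eq_sym //= (bigD1 r) ?rp //= big1 ?addr0 ?addrA //.
by move=> k /andP[/andP[kp kq] kr]; case: (all3 k) kp kq kr => ->; rewrite eqxx.
Qed.

(** * The Euclidean norm on three-dimensional space *)

Section EuclideanNorm.
Variable R : realType.
Implicit Types u v : 'cV[R]_3.

Lemma dotDl u v w : dot (u + v) w = dot u w + dot v w.
Proof. by rewrite -big_split; apply: eq_bigr => i _; rewrite !mxE mulrDl. Qed.

Lemma dotZl a u w : dot (a *: u) w = a * dot u w.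
Proof. by rewrite mulr_sumr; apply: eq_bigr => i _; rewrite !mxE mulrA. Qed.

Lemma dotC u v : dot u v = dot v u.
Proof. by apply: eq_bigr => i _; rewrite mulrC. Qed.

Lemma dotBl u v w : dot (u - v) w = dot u w - dot v w.
Proof. by rewrite dotDl -scaleN1r dotZl mulN1r. Qed.

Lemma dot0l u : dot 0 u = 0.
Proof. by rewrite -(scale0r 0) dotZl mul0r. Qed.

Lemma dot_suml (I : finType) (F : I -> 'cV[R]_3) u :
  dot (\sum_k F k) u = \sum_k dot (F k) u.
Proof.
by apply: (big_ind2 (fun a b => dot a u = b)) => [|a1 a2 b1 b2 <- <-|//];
  rewrite ?dot0l ?dotDl.
Qed.

Lemma dot_ge0 u : 0 <= dot u u.
Proof. by apply: sumr_ge0 => i _; rewrite -expr2 sqr_ge0. Qed.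

Lemma enorm_ge0 u : 0 <= enorm u. Proof. exact: sqrtr_ge0. Qed.

Lemma sqr_enorm u : enorm u ^+ 2 = dot u u.
Proof. by rewrite sqr_sqrtr ?dot_ge0. Qed.

Lemma enormZ a u : enorm (a *: u) = `|a| * enorm u.
Proof.
by rewrite /enorm dotZl dotC dotZl mulrA -expr2 sqrtrM ?sqr_ge0 // sqrtr_sqr.
Qed.

Lemma enormN u : enorm (- u) = enorm u.
Proof. by rewrite -scaleN1r enormZ normrN1 mul1r. Qed.

Lemma enormB u v : enorm (u - v) = enorm (v - u).
Proof. by rewrite -enormN opprB. Qed.

Lemma dot_le_enorm u v : dot u v <= enorm u * enorm v.
Proof.
apply: (le_trans (ler_norm _)).
rewrite -(@ler_sqr R) ?nnegrE ?mulr_ge0 ?enorm_ge0 //.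
rewrite exprMn !sqr_enorm real_normK ?num_real // /dot !big_ord_recl !big_ord0.
set x := u _ _; set y := u _ _; set z := u _ _.
set x' := v _ _; set y' := v _ _; set z' := v _ _.
(* Lagrange's identity: the two sides differ by the sum of these three squares. *)
have := sqr_ge0 (x * y' - y * x'); have := sqr_ge0 (x * z' - z * x').
by have := sqr_ge0 (y * z' - z * y'); nra.
Qed.

Lemma enormD u v : enorm (u + v) <= enorm u + enorm v.
Proof.
rewrite -(@ler_sqr R) ?nnegrE ?addr_ge0 ?enorm_ge0 //.
rewrite sqrrD !sqr_enorm dotDl ![dot _ (u + v)]dotC !dotDl (dotC v u).
have := dot_le_enorm u v; lra.
Qed.

Lemma coord_le_enorm u i : `|u i 0| <= enorm u.
Proof.
rewrite -(@ler_sqr R) ?nnegrE ?enorm_ge0 // sqr_enorm real_normK ?num_real //.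
rewrite /dot (bigD1 i) //= expr2 lerDl sumr_ge0 // => k _.
by rewrite -expr2 sqr_ge0.
Qed.

End EuclideanNorm.

(** * The smallest side of a flat triangle *)

Section SmallestSide.
Variable R : realType.
Implicit Types g : 'I_3 -> 'cV[R]_3.

(** Eliminating [gp] through the positive relation turns the combination inside [C] into
    [- (A *: gq + B *: gr)], where [A] is at least 1 and at least [la = bq / bp]. Dividing by [A]
    places [gq] near the line of [gr]; multiplying the result by [la] then does the same for
    [gp]. *)
Lemma near_line (gp gq gr : 'cV[R]_3) (a al be bp bq br : R) :
  1 <= a -> 1 <= al -> 0 <= be -> 0 < bp -> 0 < bq -> 0 < br ->
  bp *: gp + bq *: gq + br *: gr = 0 ->
  let C := enorm (a *: gp - al *: gq - be *: gr) in
  exists t u, [/\ 0 <= t, enorm (gq + t *: gr) <= C & enorm (gp - u *: gr) <= C].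
Proof.
move=> a1 al1 be0 bp0 bq0 br0 b0 C.
pose la := bq / bp; pose mu := br / bp.
have la0 : 0 < la by rewrite divr_gt0.
have mu0 : 0 < mu by rewrite divr_gt0.
have gpE : gp = - (la *: gq + mu *: gr).
  apply: (@scalerI _ _ bp); first by rewrite gt_eqF.
  rewrite scalerN scalerDr !scalerA /la /mu !(mulrC bp) !divfK ?gt_eqF //.
  by apply/eqP; rewrite -addr_eq0 addrA b0.
pose A := al + a * la; pose B := be + a * mu.
have aa : 0 < a by lra.
have A1 : 1 <= A by rewrite /A; have := mulr_gt0 aa la0; lra.
have B0 : 0 <= B by rewrite /B; have := mulr_gt0 aa mu0; lra.
have A0 : 0 < A by lra.
have E : a *: gp - al *: gq - be *: gr = - (A *: gq + B *: gr).
  rewrite gpE; apply/matrixP => i j; rewrite !mxE /A /B; ring.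
have CE : C = A * enorm (gq + (B / A) *: gr).
  rewrite /C E enormN -[X in _ = X * _]gtr0_norm // -enormZ scalerDr scalerA.
  by rewrite mulrCA mulfV ?gt_eqF // mulr1.
have laA : la <= A.
  by rewrite /A; have := ler_wpM2r (ltW la0) a1; rewrite mul1r; lra.
exists (B / A), (la * (B / A) - mu); split.
- by rewrite divr_ge0 // ltW.
- by rewrite CE -[leLHS]mul1r ler_wpM2r ?enorm_ge0.
have -> : gp - (la * (B / A) - mu) *: gr = - (la *: (gq + (B / A) *: gr)).
  by rewrite gpE; apply/matrixP => i j; rewrite !mxE; ring.
by rewrite enormN enormZ gtr0_norm // CE ler_wpM2r ?enorm_ge0.
Qed.

Lemma near_line_split_neg g (a : 'I_3 -> int) (b : 'I_3 -> R) p q :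
  (forall k, 0 < b k) -> \sum_k b k *: g k = 0 ->
  0 < a p -> a q < 0 -> (forall k, k != p -> a k <= 0) ->
  exists (v : 'cV[R]_3) (t : 'I_3 -> R) (w : 'I_3),
    [/\ t w <= 0, forall k, k != w -> 0 <= t k
      & forall k, enorm (g k - t k *: v) <= enorm (\sum_k (a k)%:~R *: g k)].
Proof.
move=> b0 bg ap aq an.
have pq : p != q by apply: contraTneq ap => ->; rewrite -leNgt ltW.
have [r [rp rq all3 sum3]] := ord3_third pq.
rewrite !sum3 in bg *.
have Hp : 1 <= (a p)%:~R :> R by rewrite ler1z -gtz0_ge1.
have Hq : 1 <= - (a q)%:~R :> R by rewrite -mulrNz ler1z -gtz0_ge1 oppr_gt0.
have Hr : 0 <= - (a r)%:~R :> R by rewrite -mulrNz ler0z oppr_ge0 an.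
have [t [u [t0 nq np]]] := near_line Hp Hq Hr (b0 p) (b0 q) (b0 r) bg.
move: nq np; rewrite !scaleNr !opprK; set C := enorm (_ + _ + _) => nq np.
have C0 : 0 <= C := enorm_ge0 _.
have pr : p != r by rewrite eq_sym.
have qr : q != r by rewrite eq_sym.
have qp : q != p by rewrite eq_sym.
(* The line is spanned by [g r]. The sign of [u] decides which vertex is alone on its side: [q] if
   [u] is nonnegative, and otherwise [r], the direction then being reversed. *)
have [u0|u0] := leP 0 u.
  exists (g r), (fun k => if k == p then u else if k == q then - t else 1), q.
  rewrite eqxx (negPf qp); split; first by rewrite oppr_le0.
    by move=> k kq; rewrite (negPf kq); case: ifP => // _; exact: ler01.
  move=> k; case: (all3 k) => ->; rewrite ?(negPf qp) ?(negPf rp) ?(negPf rq) ?eqxx //.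
    by rewrite scaleNr opprK.
  by rewrite scale1r subrr /enorm dot0l sqrtr0.
exists (- g r), (fun k => if k == p then - u else if k == q then t else -1), r.
rewrite (negPf rp) (negPf rq); split; first by rewrite lerN10.
  move=> k kr; case: ifP => [_|kp]; first by rewrite oppr_ge0 ltW.
  by case: ifP => // kq; case: (all3 k) kr kp kq => ->; rewrite eqxx.
move=> k; case: (all3 k) => ->; rewrite ?(negPf qp) ?(negPf rp) ?(negPf rq) ?eqxx //.
- by rewrite scaleNr scalerN !opprK.
- by rewrite scalerN opprK.
by rewrite scaleN1r opprK subrr /enorm dot0l sqrtr0.
Qed.

Lemma near_line_split g (a : 'I_3 -> int) (b : 'I_3 -> R) :
  (forall k, 0 < b k) -> \sum_k b k *: g k = 0 ->
  (exists k, 0 < a k) -> (exists k, a k < 0) ->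
  exists (v : 'cV[R]_3) (t : 'I_3 -> R) (w : 'I_3),
    [/\ t w <= 0, forall k, k != w -> 0 <= t k
      & forall k, enorm (g k - t k *: v) <= enorm (\sum_k (a k)%:~R *: g k)].
Proof.
move=> b0 bg [p ap] [q aq].
have pq : p != q by apply: contraTneq ap => ->; rewrite -leNgt ltW.
have [r [rp rq all3 _]] := ord3_third pq.
have [ar|ar] := leP (a r) 0.
  apply: (near_line_split_neg b0 bg ap aq) => k kp.
  by case: (all3 k) kp => -> => [|_|_] //; [rewrite eqxx | rewrite ltW].
(* If the third coefficient is positive, negating all three leaves a single positive one. *)
have -> : enorm (\sum_k (a k)%:~R *: g k) = enorm (\sum_k (- a k)%:~R *: g k).
  rewrite -enormN -sumrN; congr enorm; apply: eq_bigr => k _.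
  by rewrite mulrNz scaleNr.
apply: (@near_line_split_neg g (fun k => - a k) b q p b0 bg).
- by rewrite oppr_gt0.
- by rewrite oppr_lt0.
move=> k kq; rewrite oppr_le0.
by case: (all3 k) kq => -> => [_||_] //; [rewrite ltW | rewrite eqxx | rewrite ltW].
Qed.

Lemma smallest_side_near_line g (v : 'cV[R]_3) (t : 'I_3 -> R) w (C rho : R) i j :
  t w <= 0 -> (forall k, k != w -> 0 <= t k) ->
  (forall k, enorm (g k - t k *: v) <= C) ->
  i != j -> (forall k l, k != l -> enorm (g i - g j) <= enorm (g k - g l)) ->
  (forall k, enorm (g k) <= rho) ->
  [\/ enorm (g i - g j) <= rho, enorm (g i) <= 10 * C | enorm (g j) <= 10 * C].
Proof.
move=> tw tp near ij dmin grho.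
(* Signed position on the line of the point near [g k]. Norms are read off from it up to [C], and
   distances up to [2 C]. *)
pose x k := t k * enorm v.
have xw : x w <= 0 by rewrite mulr_le0_ge0 ?enorm_ge0.
have xp k : k != w -> 0 <= x k by move/tp => tk; rewrite mulr_ge0 ?enorm_ge0.
have nle k : enorm (g k) <= `|x k| + C.
  rewrite -[g k](subrK (t k *: v)) addrC (le_trans (enormD _ _)) // lerD //.
  by rewrite enormZ normrM (ger0_norm (enorm_ge0 v)).
have nge k : `|x k| <= enorm (g k) + C.
  rewrite normrM (ger0_norm (enorm_ge0 v)) -enormZ.
  rewrite -[t k *: v](subKr (g k)) (le_trans (enormD _ _)) // lerD2l.
  by rewrite enormN.
have dE k l : (g k - g l) - (t k - t l) *: v = (g k - t k *: v) - (g l - t l *: v).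
  by apply/matrixP => y z; rewrite !mxE; ring.
have dC k l : enorm ((g k - g l) - (t k - t l) *: v) <= C + C.
  by rewrite dE (le_trans (enormD _ _)) // enormN lerD.
have xE k l : `|x k - x l| = enorm ((t k - t l) *: v).
  by rewrite enormZ -mulrBl normrM (ger0_norm (enorm_ge0 v)).
have dle k l : enorm (g k - g l) <= `|x k - x l| + (C + C).
  rewrite -[g k - g l](subrK ((t k - t l) *: v)) addrC (le_trans (enormD _ _)) //.
  by rewrite xE lerD2l.
have dge k l : `|x k - x l| <= enorm (g k - g l) + (C + C).
  rewrite xE -[X in enorm X <= _](subKr (g k - g l)) (le_trans (enormD _ _)) //.
  by rewrite lerD2l enormN.
have C0 : 0 <= C := le_trans (enorm_ge0 _) (near w).
have [|dgt] := leP (enorm (g i - g j)) rho; first by constructor.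
have [|igt] := leP (enorm (g i)) (10 * C); first by constructor.
have [|jgt] := leP (enorm (g j)) (10 * C); first by constructor.
exfalso.
have absp k : k != w -> `|x k| = x k by move/xp/ger0_norm.
have absw : `|x w| = - x w by rewrite ler0_norm.
have [m [mi mj all3 _]] := ord3_third ij.
(* All sides exceed [rho]. For two vertices on the same side of the origin, the outer position is at
   most [rho + C] and the gap exceeds [rho - 2 C], so the inner position is below [3 C]. *)
have same k l : k != w -> l != w -> k != l ->
    enorm (g k) <= 4 * C \/ enorm (g l) <= 4 * C.
  move=> kw lw kl; have dkl := dle k l; move: (dmin k l kl) (grho k) (grho l).
  move: (nge k) (nge l) (nle k) (nle l); rewrite (absp _ kw) (absp _ lw).
  have := xp _ kw; have := xp _ lw.
  have [xkl|xkl] := leP (x l) (x k); [right|left].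
    by move: dkl; rewrite ger0_norm ?subr_ge0 //; lra.
  by move: dkl; rewrite ltr0_norm ?subr_lt0 //; lra.
have opp k : k != w -> x k - x w = `|x k - x w|.
  by move=> kw; rewrite ger0_norm // subr_ge0 (le_trans xw) ?xp.
have im : i != m by rewrite eq_sym.
have jm : j != m by rewrite eq_sym.
have [mw|mw] := eqVneq m w.
  have iw : i != w by rewrite -mw.
  have jw : j != w by rewrite -mw.
  by case: (same i j iw jw ij); lra.
have small_m k : k != w -> k != m -> 10 * C < enorm (g k) -> enorm (g m) <= 4 * C.
  by move=> kw km kgt; case: (same k m kw mw km) => //; lra.
have tri k l : enorm (g k - g l) <= enorm (g k) + enorm (g l).
  by rewrite (le_trans (enormD _ _)) // enormN.
(* Now one endpoint, say [i], is alone, and [m] is short because it shares its side with [j]. Side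
   [i j] has length at least [|g i| + |g j| - 4 C] and side [j m] at most [|g j| + 4 C], so
   minimality would give [|g i| <= 8 C]. *)
have [iw|iw] := eqVneq i w.
  have jw : j != w by rewrite -iw eq_sym.
  have := small_m j jw jm jgt; have := dge j w; have := dmin j m jm.
  have := tri j m; rewrite -(opp j jw) [enorm (g i - g j)]enormB iw.
  have := nle w; have := nle j; rewrite absw (absp _ jw) -iw; lra.
have jw : j = w by case: (all3 w) iw mw => ->; rewrite ?eqxx.
have := small_m i iw im igt; have := dge i w; have := dmin i m im.
have := tri i m; rewrite -(opp i iw) jw.
have := nle w; have := nle i; rewrite absw (absp _ iw) -jw; lra.
Qed.

End SmallestSide.

(** * Monotone potentials on heights *)

(** The two ways in which a column of height [v] takes part in a subtraction: another column is
    subtracted from it, or it is subtracted from a column at least as high. *)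
Definition drops_at (R : realType) (phi : R -> nat) (v : R) : Prop :=
  (forall z : R, 0 < z -> (phi (v - z)%R < phi v)%N) /\
  (forall y : R, v <= y -> (phi (y - v)%R < phi y)%N).

Lemma exists_dropping_potential (R : realType) (F : seq R) :
  exists2 phi : R -> nat, (forall x y, x <= y -> (phi x <= phi y)%N) &
    forall v, v \in F -> 0 < v -> drops_at phi v.
Proof.
elim: F => [|v F [phi phi_mono phiF]]; first by exists (fun=> 0%N).
have [v0|v0] := leP v 0.
  exists phi => // w; rewrite inE => /orP[/eqP->|]; last exact: phiF.
  by rewrite ltNge v0.
(* The indicator provides the drop from [v] to anything below it, the truncated quotient the drop
   when [v] is subtracted. Adding [psi] keeps the earlier drops, since it is monotone. *)
pose psi x : nat := ((v <= x)%R + Num.truncn (x / v)%R)%N.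
have psi_mono x y : x <= y -> (psi x <= psi y)%N.
  move=> xy; apply: leq_add; last by rewrite le_truncn // ler_pM2r ?invr_gt0.
  by case: (leP v x) => // /le_trans /(_ xy) ->.
exists (fun x => phi x + psi x)%N.
  by move=> x y xy; rewrite leq_add ?phi_mono ?psi_mono.
move=> w; rewrite inE => /predU1P[->|wF] w0; split.
- move=> z z0; rewrite -addnS leq_add ?phi_mono ?gerBl ?ltW //.
  rewrite /psi lexx leNgt gtrBl z0 add0n add1n ltnS.
  by rewrite le_truncn // ler_pM2r ?invr_gt0 // gerBl ltW.
- move=> y vy; rewrite -addnS leq_add ?phi_mono ?gerBl ?ltW //.
  rewrite /psi vy add1n ltnS.
  have yv : 1 <= y / v by rewrite ler_pdivlMr // mul1r.
  have -> : Num.truncn (y / v) = (Num.truncn ((y - v) / v)).+1.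
    have -> : y / v = (y - v) / v + 1%:R.
      by rewrite mulrBl divff ?gt_eqF // subrK.
    rewrite addrC truncnD ?natr_nat ?natrK ?add1n //.
    by rewrite mulrBl divff ?gt_eqF // nnegrE subr_ge0.
  by rewrite -add1n leq_add2r leq_b1.
- have [d _] := phiF w wF w0; move=> z z0.
  by rewrite -addSn leq_add ?d ?psi_mono // gerBl ltW.
have [_ d] := phiF w wF w0; move=> y wy.
by rewrite -addSn leq_add ?d ?psi_mono // gerBl ltW.
Qed.

(** * Integer vectors, split into height and projection *)

Section Lattice.
Variables (R : realType) (X : 'cV[R]_3).
Hypothesis X_neq0 : X != 0.
Implicit Types h : 'cV[int]_3.

Definition height h : R := dot (rvec R h) X.
Definition transv h : 'cV[R]_3 := projP X (rvec R h).

Lemma rvecB h1 h2 : rvec R (h1 - h2) = rvec R h1 - rvec R h2.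
Proof. by apply/matrixP => i j; rewrite !mxE rmorphB. Qed.

Lemma rvec_mulmx (G : 'M[int]_3) (a : 'cV[int]_3) :
  rvec R (G *m a) = \sum_k (a k 0)%:~R *: rvec R (col k G).
Proof.
apply/matrixP => i j; rewrite ord1 !mxE summxE rmorph_sum; apply: eq_bigr => k _.
by rewrite !mxE rmorphM mulrC.
Qed.

Lemma projP_sum (I : finType) (a : I -> R) (F : I -> 'cV[R]_3) :
  projP X (\sum_k a k *: F k) = \sum_k a k *: projP X (F k).
Proof.
rewrite /projP /projD dot_suml mulr_suml scaler_suml -sumrB.
by apply: eq_bigr => k _; rewrite dotZl scalerBr scalerA mulrA.
Qed.

Lemma projPB u v : projP X (u - v) = projP X u - projP X v.
Proof. by rewrite /projP /projD dotBl mulrBl scalerBl !opprD addrACA. Qed.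

Lemma projP_X : projP X X = 0.
Proof. by rewrite /projP /projD divff ?dot_neq0 // scale1r subrr. Qed.

Lemma enorm_gt0 : 0 < enorm X.
Proof. by rewrite lt_neqAle enorm_ge0 eq_sym -sqrf_eq0 sqr_enorm dot_neq0. Qed.

Lemma enorm_projD u : enorm (projD X u) = `|dot u X| / enorm X.
Proof.
rewrite enormZ normf_div -sqr_enorm normrX (ger0_norm (enorm_ge0 X)) expr2.
by rewrite invfM mulrA divfK // gt_eqF ?enorm_gt0.
Qed.

Lemma heightB h1 h2 : height (h1 - h2) = height h1 - height h2.
Proof. by rewrite /height rvecB dotBl. Qed.

Lemma transvB h1 h2 : transv (h1 - h2) = transv h1 - transv h2.
Proof. by rewrite /transv rvecB projPB. Qed.

Lemma bounded_coord (K Y : R) : exists M : nat, forall h,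
  enorm (transv h) <= K -> `|height h| <= Y -> forall i, (`|h i 0%R| <= M)%N.
Proof.
exists (Num.bound (K + Y / enorm X)) => h hK hY i.
have /(le_trans (coord_le_enorm (rvec R h) i)) : enorm (rvec R h) <= K + Y / enorm X.
  rewrite -(projPD X (rvec R h)) (le_trans (enormD _ _)) // lerD //.
  by rewrite enorm_projD ler_pM2r ?invr_gt0 ?enorm_gt0.
rewrite mxE -intr_norm -abszE -pmulrn => le.
rewrite -(ler_nat R) (le_trans le) // ltW // archi_boundP //.
exact: le_trans le.
Qed.

Lemma bounded_heights (M : nat) : exists F : seq R,
  forall h, (forall i, (`|h i 0%R| <= M)%N) -> height h \in F.
Proof.
(* Ordinals shifted by [M] enumerate the coordinates from [-M] to [M]. *)
pose vec (e : {ffun 'I_3 -> 'I_(M + M).+1}) : 'cV[int]_3 :=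
  \col_i ((e i)%:Z - M%:Z).
exists [seq height (vec e) | e : {ffun 'I_3 -> 'I_(M + M).+1}] => h hM.
apply/imageP; exists [ffun i => inord `|(h i 0 + M%:Z)%R|%N] => //.
congr height; apply/matrixP => i j; rewrite ord1 mxE ffunE.
have hM0 : 0 <= h i 0 + M%:Z by have := hM i; lia.
rewrite inordK; first by rewrite gez0_abs // addrK.
by have := hM i; lia.
Qed.

(** Only finitely many integer vectors satisfy both bounds, so a single potential serves all of
    them. *)
Lemma bounded_potential (K Y : R) :
  exists2 phi : R -> nat, (forall x y, x <= y -> (phi x <= phi y)%N) &
    forall h, enorm (transv h) <= K -> 0 < height h <= Y -> drops_at phi (height h).
Proof.
have [M HM] := bounded_coord K Y.
have [F HF] := bounded_heights M.
have [phi phi_mono phiF] := exists_dropping_potential F.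
exists phi => // h hK /andP[h0 hY]; apply: phiF => //.
by apply: HF; apply: HM => //; rewrite gtr0_norm.
Qed.

Lemma smallest_side (G : 'M[int]_3) (c : 'cV[int]_3) (b : 'I_3 -> R) rho i j :
  G \in unitmx -> (forall k, 0 < b k) -> \sum_k b k *: rvec R (col k G) = X ->
  (forall k, 0 < height (col k G)) -> c != 0 -> height c = 0 ->
  i != j -> (forall k l, k != l -> SVA_dist X G i j <= SVA_dist X G k l) ->
  (forall k, enorm (transv (col k G)) <= rho) ->
  [\/ SVA_dist X G i j <= rho, enorm (transv (col i G)) <= 10 * enorm (transv c)
    | enorm (transv (col j G)) <= 10 * enorm (transv c)].
Proof.
move=> Gu b0 bG y0 c0 yc ij dmin trho.
pose a := invmx G *m c.
have cE : c = G *m a by rewrite mulKVmx.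
have a0 : exists k, a k 0 != 0.
  apply/existsP; apply: contraNT c0; rewrite negb_exists => /forallP a0.
  rewrite cE; suff -> : a = 0 by rewrite mulmx0.
  by apply/matrixP => k l; rewrite ord1 [RHS]mxE; apply/eqP; have := a0 k; rewrite negbK.
have rc := rvec_mulmx G a; rewrite -cE in rc.
have ya : \sum_k (a k 0)%:~R * height (col k G) = 0.
  by rewrite -[RHS]yc {2}/height rc dot_suml; apply: eq_bigr => k _; rewrite dotZl.
(* Applied with [s] equal to 1 and to -1, this yields both signs. If no [s * a k 0] were positive,
   [ya] would be a vanishing sum of terms of one sign, and [a] would be zero. *)
have noneg (s : int) : s != 0 -> exists k, 0 < s * a k 0.
  move=> s0; apply/existsP; apply: contraT; rewrite negb_exists => /forallP an.
  case: a0 => k; have /(_ k isT) :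
      forall k, true -> - (s * a k 0)%:~R * height (col k G) = 0.
    apply: psumr_eq0P => [l _|].
      by rewrite mulr_ge0 ?(ltW (y0 l)) // -mulrNz ler0z oppr_ge0 leNgt an.
    transitivity (- s%:~R * \sum_l (a l 0)%:~R * height (col l G)).
      rewrite mulr_sumr; apply: eq_bigr => l _.
      by rewrite rmorphM /= !mulNr mulrA.
    by rewrite ya mulr0.
  move/eqP; rewrite mulf_eq0 (gt_eqF (y0 k)) orbF oppr_eq0 intr_eq0 mulf_eq0.
  by rewrite (negPf s0) /= => ->.
have bt : \sum_k b k *: transv (col k G) = 0 by rewrite -projP_sum bG projP_X.
have ct : \sum_k (a k 0)%:~R *: transv (col k G) = transv c by rewrite -projP_sum -rc.
have apos : exists k, 0 < a k 0 by have [//|k] := noneg 1; rewrite mul1r; exists k.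
have aneg : exists k, a k 0 < 0.
  by have [//|k] := noneg (-1); rewrite mulN1r oppr_gt0; exists k.
have [v [t [w [tw tp near]]]] := near_line_split b0 bt apos aneg.
rewrite ct in near.
have distE k l : SVA_dist X G k l = enorm (transv (col k G) - transv (col l G)).
  exact: enormB.
rewrite distE; apply: (smallest_side_near_line tw tp near ij _ trho) => k l kl.
by rewrite -!distE dmin.
Qed.

End Lattice.

(** * One step of the algorithm and its invariants *)

Section Algorithm.
Variables (R : realType) (X : 'cV[R]_3).
Hypotheses (X_gt0 : 0 < X 0 0) (X01 : X 0 0 < X 1 0) (X12 : X 1 0 < X 2 0).
Implicit Types G : 'M[int]_3.

Local Notation heightX := (height X).
Local Notation transv := (transv X).

Lemma X_neq0 : X != 0.
Proof. by apply: contraTneq X_gt0 => ->; rewrite mxE ltxx. Qed.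

Lemma integer_relation : rationally_dependent X ->
  exists2 c : 'cV[int]_3, c != 0 & heightX c = 0.
Proof.
case=> q q0 qX.
(* The rational relation multiplied by the product of its three denominators. *)
pose c : 'cV[int]_3 :=
  \col_k (numq (q k 0) * \prod_(l | l != k) denq (q l 0)).
have den0 P : \prod_(l | P l) denq (q l 0) != 0.
  by apply/prodf_neq0 => l _; rewrite denq_neq0.
exists c.
  apply: contraNneq q0 => c0; apply/eqP/matrixP => k l; rewrite ord1 [RHS]mxE.
  have /eqP : c k 0 = 0 by rewrite c0 mxE.
  by rewrite mxE mulf_eq0 (negPf (den0 _)) orbF numq_eq0 => /eqP.
transitivity ((\prod_l denq (q l 0))%:~R * \sum_i ratr (q i 0) * X i 0);
  last by rewrite qX mulr0.
rewrite mulr_sumr; apply: eq_bigr => k _; rewrite mulrA !mxE.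
rewrite [\prod_l denq _](bigD1 k) //=.
congr (_ * _); rewrite !intrM /ratr; field.
by rewrite intr_eq0 denq_neq0.
Qed.

(** Treats the three branches of [SVA_subtract] uniformly in the pair of indices. *)
Definition replace_col G (i j k : 'I_3) : 'cV[int]_3 :=
  if k == j then col j G - col i G else col k G.

Lemma mx_of_colsE G (i j : 'I_3) :
  mx_of_cols (replace_col G i j 0) (replace_col G i j 1) (replace_col G i j 2)
  = G *m (1%:M - delta_mx i j).
Proof.
apply/matrixP => r k; rewrite mulmxBr mulmx1 !mxE.
rewrite (bigD1 i) //= big1 ?addr0; last first.
  by move=> l /negPf li; rewrite mxE li mulr0.
rewrite mxE eqxx /= mulr_natr.
have -> : nth 0 [:: replace_col G i j 0; replace_col G i j 1;
                    replace_col G i j 2] k = replace_col G i j k.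
  by case: k => [[|[|[|k]]]] // kP; congr replace_col; apply: val_inj.
by rewrite /replace_col; case: eqP => [->|_]; rewrite !mxE ?mulr1n // mulr0n subr0.
Qed.

Lemma SVA_distC G i j : SVA_dist X G i j = SVA_dist X G j i.
Proof. exact: enormB. Qed.

Lemma SVA_dmin_le G i j : i != j -> SVA_dmin X G <= SVA_dist X G i j.
Proof.
wlog: i j / (i < j)%N.
  move=> wl ij; have := ij; rewrite -val_eqE neq_ltn => /orP[|] lt; first exact: wl.
  by rewrite SVA_distC wl // eq_sym.
by case: (ord3P i) (ord3P j) => -> [] -> // _ _; rewrite /SVA_dmin !ge_min lexx ?orbT.
Qed.

Lemma SVA_stepE G G' : SVA_step X G G' -> exists (i j : 'I_3) (s : 'S_3),
  [/\ (i < j)%N, forall k l, k != l -> SVA_dist X G i j <= SVA_dist X G k l,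
      G' = col_perm s (G *m (1%:M - delta_mx i j)),
      forall k, col k G' = replace_col G i j (s k) & SVA_sorted X G'].
Proof.
move=> [F [s [FG -> srt]]].
suff [i [j [ij d FE]]] : exists i j : 'I_3, [/\ (i < j)%N,
    SVA_dmin X G = SVA_dist X G i j & F = mx_of_cols (replace_col G i j 0)
      (replace_col G i j 1) (replace_col G i j 2)].
  exists i, j, s; split=> //; first by move=> k l kl; rewrite -d SVA_dmin_le.
    by rewrite FE mx_of_colsE.
  move=> k; apply/matrixP => r z; rewrite ord1 !mxE FE mxE.
  by case: (s k) => [[|[|[|m]]]] // mP; congr (replace_col _ _ _ _ _ _); apply: val_inj.
by case: FG => d; [exists 0, 1 | exists 1, 2 | exists 0, 2].
Qed.

(** Invertibility over the integers gives the relation integer coordinates in the columns; the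
    positive combination projects to a positive relation among the [g_k']; the upper bound on
    heights makes the relevant sets finite; the ordering keeps differences of heights
    nonnegative. *)
Definition SVA_inv G : Prop :=
  [/\ G \in unitmx,
      exists2 b : 'I_3 -> R, (forall k, 0 < b k)
        & \sum_k b k *: rvec R (col k G) = X,
      forall k, 0 <= heightX (col k G) <= X 2 0
    & forall i j : 'I_3, (i < j)%N -> heightX (col i G) <= heightX (col j G)].

Lemma sum_replace_col G G' i j (s : 'S_3) (F : 'cV[int]_3 -> nat) :
  (forall k, col k G' = replace_col G i j (s k)) ->
  (\sum_k F (col k G') =
     \sum_(k | k != j) F (col k G) + F (col j G - col i G)%R)%N.
Proof.
move=> G'E; under eq_bigr do rewrite G'E.
transitivity (\sum_k F (replace_col G i j k))%N.
  by rewrite [RHS](reindex_inj (@perm_inj _ s)).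
rewrite (bigD1 j) //= addnC /replace_col eqxx; congr (_ + _)%N.
by apply: eq_bigr => k /negPf ->.
Qed.

Lemma SVA_inv1 : SVA_inv 1%:M.
Proof.
have hE k : heightX (col k 1%:M) = X k 0.
  rewrite /height /dot (bigD1 k) //= big1 ?addr0; last first.
    by move=> l /negPf lk; rewrite !mxE lk mul0r.
  by rewrite !mxE eqxx mul1r.
split; first exact: unitmx1.
- exists (fun k => X k 0).
    by move=> k; case: (ord3P k) => ->; move: X_gt0 X01 X12; lra.
  apply/matrixP => r z; rewrite ord1 summxE (bigD1 r) //= big1 ?addr0; last first.
    by move=> l /negPf lr; rewrite !mxE eq_sym lr mulr0.
  by rewrite !mxE eqxx mulr1.
- by move=> k; rewrite hE; case: (ord3P k) => ->; move: X_gt0 X01 X12; lra.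
by move=> i j; rewrite !hE; case: (ord3P i) (ord3P j) => -> [] -> //= _;
  move: X_gt0 X01 X12; lra.
Qed.

Lemma SVA_inv_step G G' : SVA_inv G -> SVA_step X G G' -> SVA_inv G'.
Proof.
move=> [Gu [b b0 bX] y0 ysort] /SVA_stepE [i [j [s [ij _ G'E colE srt]]]].
have nij : i != j by rewrite -val_eqE neq_ltn ij.
have y'0 k : 0 <= heightX (col k G') <= X 2 0.
  rewrite colE /replace_col; case: ifP => // _; rewrite heightB.
  by have := ysort i j ij; have := y0 i; have := y0 j; lra.
split=> //.
- rewrite G'E col_permE unitmx_mul unitmx_perm andbT unitmx_mul Gu /=.
  have: (1%:M - delta_mx i j) *m (1%:M + delta_mx i j) = 1%:M :> 'M[int]_3.
    rewrite mulmxDr mulmx1 mulmxBl mul1mx mul_delta_mx_0 1?eq_sym // subr0.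
    by rewrite subrK.
  by case/mulmx1_unit.
(* From [b_i g_i + b_j g_j = (b_i + b_j) g_i + b_j (g_j - g_i)]. *)
- pose b' k := if k == i then b i + b j else b k.
  exists (fun k => b' (s k)).
    by move=> k; rewrite /b'; case: ifP => // _; rewrite addr_gt0.
  under eq_bigr do rewrite colE.
  transitivity (\sum_k b' k *: rvec R (replace_col G i j k)).
    by rewrite [RHS](reindex_inj (@perm_inj _ s)).
  have [m [mi mj _ sum3]] := ord3_third nij; rewrite sum3 -{}bX sum3.
  rewrite /b' /replace_col !eqxx (negPf nij) (negPf mi) (negPf mj) eq_sym (negPf nij).
  rewrite rvecB scalerBr scalerDl; congr (_ + _); rewrite -addrA; congr (_ + _).
  by rewrite addrC subrK.
(* Since heights are nonnegative, sorting by the norm of [h''] is sorting by height. *)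
move: srt; rewrite /SVA_sorted !enorm_projD ?X_neq0 //.
rewrite !ler_pM2r ?invr_gt0 ?enorm_gt0 ?X_neq0 //.
have absE k : `|dot (rvec R (col k G')) X| = heightX (col k G').
  by rewrite ger0_norm //; case/andP: (y'0 k).
rewrite !absE => /andP[h01 h12] k l.
by case: (ord3P k) (ord3P l) => -> [] -> //= _; lra.
Qed.

Definition potential (phi : R -> nat) G : nat := (\sum_k phi (heightX (col k G)))%N.

Lemma potential_lt (phi : R -> nat) G G' i j (s : 'S_3) :
  (forall k, col k G' = replace_col G i j (s k)) ->
  (phi (heightX (col j G) - heightX (col i G))%R < phi (heightX (col j G)))%N ->
  (potential phi G' < potential phi G)%N.
Proof.
move=> colE lt; rewrite /potential (sum_replace_col (fun h => phi (heightX h)) colE).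
by rewrite [ltnRHS](bigD1 j) //= heightB addnC ltn_add2r.
Qed.

Lemma potential_le (phi : R -> nat) G G' i j (s : 'S_3) :
  (forall x y, x <= y -> (phi x <= phi y)%N) -> 0 <= heightX (col i G) ->
  (forall k, col k G' = replace_col G i j (s k)) ->
  (potential phi G' <= potential phi G)%N.
Proof.
move=> mono y0 colE; rewrite /potential (sum_replace_col (fun h => phi (heightX h)) colE).
by rewrite [leqRHS](bigD1 j) //= heightB addnC leq_add2r mono // gerBl.
Qed.

Variable G : nat -> 'M[int]_3.
Hypothesis G_run : SVA_run X G.

Lemma SVA_run_inv s : SVA_inv (G s).
Proof.
case: G_run => G0 Gs; elim: s => [|s IHs]; first by rewrite G0; exact: SVA_inv1.
exact: SVA_inv_step (Gs s).
Qed.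

(** * Impossibility of a run in which no height vanishes *)

Section NoRelation.
Hypothesis height_gt0 : forall s k, 0 < heightX (col k (G s)).

Lemma height_bounds s k : 0 < heightX (col k (G s)) <= X 2 0.
Proof.
by rewrite height_gt0; case: (SVA_run_inv s) => _ _ /(_ k) /andP[].
Qed.

Lemma transv_bounded : rationally_dependent X ->
  exists B : R, forall s k, enorm (transv (col k (G s))) <= B.
Proof.
move=> /integer_relation [c c0 yc].
have [phi mono drop] := bounded_potential X_neq0 (10 * enorm (transv c)) (X 2 0).
pose N s := potential phi (G s).
pose B := (\sum_k enorm (transv (col k (G 0%N)))) * 2 ^+ N 0%N.
suff bnd s k : enorm (transv (col k (G s))) * 2 ^+ N s <= B.
  exists B => s k; apply: le_trans (bnd s k).
  by rewrite ler_peMr ?enorm_ge0 // exprn_ege1 // ler1n.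
elim: s k => [|s IHs] k.
  rewrite ler_wpM2r ?exprn_ge0 // (bigD1 k) //= lerDl sumr_ge0 // => l _.
  exact: enorm_ge0.
have [i [j [p [ij dmin _ colE _]]]] := SVA_stepE (proj2 G_run s).
have nij : i != j by rewrite -val_eqE neq_ltn ij.
have pow_gt0 n : 0 < 2 ^+ n :> R by rewrite exprn_gt0.
(* The bound supplied by the induction hypothesis, in place of the actual maximum of the norms. *)
pose rho := B / 2 ^+ N s.
have trho l : enorm (transv (col l (G s))) <= rho by rewrite ler_pdivlMr.
have rho0 : 0 <= rho := le_trans (enorm_ge0 _) (trho 0).
have NE : (N s.+1 <= N s)%N by apply: potential_le colE => //; exact: ltW.
have pow_le m n : (m <= n)%N -> 2 ^+ m <= 2 ^+ n :> R.
  by move=> mn; rewrite ler_eXn2l // ltr1n.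
have not_grown : enorm (transv (col k (G s.+1))) <= rho ->
    enorm (transv (col k (G s.+1))) * 2 ^+ N s.+1 <= B.
  move=> le; apply: (@le_trans _ _ (rho * 2 ^+ N s)).
    by rewrite ler_pM ?enorm_ge0 ?(ltW (pow_gt0 _)) ?pow_le.
  by rewrite divfK // gt_eqF.
case: (eqVneq (p k) j) => [pk|pk]; last first.
  by apply: not_grown; rewrite colE /replace_col (negPf pk).
have dE : enorm (transv (col k (G s.+1))) = SVA_dist X (G s) i j.
  by rewrite colE /replace_col pk eqxx transvB.
(* A strict drop of [N] pays for the doubling allowed by the triangle inequality. *)
have grown : (N s.+1 < N s)%N -> enorm (transv (col k (G s.+1))) * 2 ^+ N s.+1 <= B.
  move=> lt; apply: (@le_trans _ _ (rho * 2 ^+ N s)); last by rewrite divfK // gt_eqF.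
  apply: (@le_trans _ _ (rho * 2 ^+ (N s.+1).+1)); last first.
    by rewrite ler_wpM2l // pow_le.
  rewrite exprS mulrA ler_wpM2r ?(ltW (pow_gt0 _)) // dE.
  rewrite (le_trans (enormD _ _)) // enormN mulr_natr mulr2n lerD //; exact: trho.
have [Gu [b b0 bX] _ ysort] := SVA_run_inv s.
(* Either the new column stays within [rho], or the subtracted column [i] is short, or the reduced
   column [j] is; the last two cases use the two halves of [drops_at]. *)
case: (smallest_side X_neq0 Gu b0 bX (height_gt0 s) c0 yc nij dmin trho) => small.
- by apply: not_grown; rewrite dE.
- apply/grown/(potential_lt colE).
  by apply: (drop _ small (height_bounds s i)).2; exact: ysort.
- apply/grown/(potential_lt colE).
  by apply: (drop _ small (height_bounds s j)).1.
Qed.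

Lemma no_run_without_relation : ~ rationally_dependent X.
Proof.
move=> /transv_bounded [B trB].
have [phi _ drop] := bounded_potential X_neq0 B (X 2 0).
(* With every projection within [B], the reduced column always makes the potential drop, so the
   number of steps is at most its initial value. *)
have desc s : (potential phi (G s) + s <= potential phi (G 0%N))%N.
  elim: s => [|s IHs]; first by rewrite addn0.
  have [i [j [p [_ _ _ colE _]]]] := SVA_stepE (proj2 G_run s).
  apply: leq_trans IHs; rewrite addnS -addSn leq_add2r.
  by apply: (potential_lt colE); apply: (drop _ (trB s j) (height_bounds s j)).1.
by have := desc (potential phi (G 0%N)).+1; rewrite addnS ltnNge leq_addl.
Qed.

End NoRelation.
End Algorithm.

Theorem theorem4 (R : realType) (X : 'cV[R]_3)
    (X_gt0 : 0 < X 0 0) (X01 : X 0 0 < X 1 0) (X12 : X 1 0 < X 2 0)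
    (X_dep : rationally_dependent X)
    (G : nat -> 'M[int]_3) (G_run : SVA_run X G) :
  exists s : nat,
    [/\ enorm (projD X (rvec R (col 0 (G s)))) = 0,
        dot (rvec R (col 0 (G s))) X = 0,
        col 0 (G s) != 0
      & (G s 0 0)%:~R * X 0 0 + (G s 1 0)%:~R * X 1 0
          + (G s 2 0)%:~R * X 2 0 = 0].
Proof.
have inv := SVA_run_inv X_gt0 X01 X12 G_run.
have [s y0] : exists s, height X (col 0 (G s)) = 0.
  (* Column 0 has the least height, so if its height never vanishes, all heights stay positive. *)
  apply: contrapT => none.
  apply: (no_run_without_relation X_gt0 X01 X12 G_run _ X_dep) => s k.
  have [_ _ y0 ysort] := inv s.
  have y00 : 0 < height X (col 0 (G s)).
    by rewrite lt_neqAle; case/andP: (y0 0) => -> _; rewrite andbT; apply/eqP => e;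
      apply: none; exists s.
  case: (posnP k) => [k0|k0]; last exact: lt_le_trans (ysort 0 k k0).
  by have -> : k = 0 by apply: val_inj.
exists s; split=> //.
- by rewrite enorm_projD ?X_neq0 // -/(height X _) y0 normr0 mul0r.
- have [Gu _ _ _] := inv s; apply: contraTneq Gu => c0.
  rewrite unitmxE (expand_det_col _ 0) big1 ?unitr0 // => k _.
  by have /matrixP /(_ k 0) := c0; rewrite !mxE => ->; rewrite mul0r.
move: y0; rewrite /height /dot !big_ord_recl big_ord0 !mxE addr0 addrA.
have -> : lift ord0 (lift ord0 ord0) = 2 :> 'I_3 by apply: val_inj.
have -> : lift ord0 ord0 = 1 :> 'I_3 by apply: val_inj.
by [].
Qed.
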